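(* Let $G=G_+G_-$ be a unique factorization of a finite group $G$, and let $\xi,\eta:G_+\to G_-$ be two group homomorphisms. Put \[ G_+'=\{u\,\xi(u^{-1}) : u\in G_+\},\qquad G_+''=\{\eta(u^{-1})\,u : u\in G_+\}, \] and $F:G_+'\to G_+''$, $F(u\xi(u^{-1}))=\eta(u)u^{-1}$. Suppose that (a) both $G_+'$ and $G_+''$ are normal subgroups of $G$, and (b) $F$ is a group isomorphism. Then \[ R=\sum_{u,v\in G_+}\{u\,(\eta(v)^{u})^{-1}\}\otimes\{v\,\xi(u)\} \] is a positive quasi-triangular structure on $H(G;G_+,G_-)$. Conversely, every positive quasi-triangular structure on $H(G;G_+,G_-)$ arises in this way from some pair of group homomorphisms $\xi,\eta:G_+\to G_-$ satisfying (a) and (b).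
   Context: A unique factorization $G=G_+G_-$ of a group $G$ consists of subgroups $G_+,G_-$ such that every $g\in G$ can be written uniquely as $g=g_+g_-$ with $g_+\in G_+$, $g_-\in G_-$ (then also uniquely as $g=\bar g_-\bar g_+$ with $\bar g_-\in G_-$, $\bar g_+\in G_+$). For $u\in G_+$ and $x\in G_-$ define ${}^u x\in G_-$, $u^x\in G_+$, ${}^x u\in G_+$, $x^u\in G_-$ by $ux=({}^u x)(u^x)$ and $xu=({}^x u)(x^u)$. $H(G;G_+,G_-)$ is the complex vector space with basis $\{g\}$, $g\in G$, and Hopf algebra structure: $\{g\}\{h\}=\delta_{g_+^{\,g_-},\,h_+}\{g h_-\}$; unit $1=\sum_{u\in G_+}\{u\}$; $\Delta\{g\}=\sum_{h\in G_+}\{g_+h^{-1}({}^{h}g_-)\}\otimes\{h g_-\}$; $\varepsilon\{g\}=\delta_{g_+,e}$; $S\{g\}=\{g^{-1}\}$. A quasi-triangular structure on a Hopf algebra $H$ is an invertible $R\in H\otimes H$ with $\tau\Delta(a)=R\Delta(a)R^{-1}$ for all $a\in H$ ($\tau$ the flip), $(\Delta\otimes\mathrm{id})R=R_{13}R_{23}$, $(\mathrm{id}\otimes\Delta)R=R_{13}R_{12}$, and $(\varepsilon\otimes\mathrm{id})R=(\mathrm{id}\otimes\varepsilon)R=1$. An element of $H(G;G_+,G_-)\otimes H(G;G_+,G_-)$ is positive if it is a linear combination of the elements $\{g\}\otimes\{h\}$, $g,h\in G$, with non-negative real coefficients. *)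

(* Defs.v *)
From mathcomp Require Import all_boot all_order all_algebra all_fingroup.
Set Implicit Arguments. Unset Strict Implicit. Unset Printing Implicit Defensive.
Import GRing.Theory Num.Theory.

Local Open Scope group_scope.

Section BicrossedHopf.
Variables (gT : finGroupType) (Gp Gm : {group gT}) (C : numClosedFieldType).

Definition unique_factorization : Prop :=
  forall g : gT, exists! p : gT * gT, [/\ p.1 \in Gp, p.2 \in Gm & g = p.1 * p.2].

(** g = g_+ g_-  (well defined under unique_factorization) *)
Definition gplus (g : gT) : gT := odflt 1 [pick u in Gp | u^-1 * g \in Gm].
Definition gminus (g : gT) : gT := (gplus g)^-1 * g.
Definition bminus (g : gT) : gT := odflt 1 [pick x in Gm | x^-1 * g \in Gp].
Definition bplus (g : gT) : gT := (bminus g)^-1 * g.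

(** u x = (^u x)(u^x),  x u = (^x u)(x^u)  for u in G_+, x in G_- *)
Definition lact_pm (u x : gT) : gT := bminus (u * x).
Definition ract_pm (u x : gT) : gT := bplus (u * x).
Definition lact_mp (x u : gT) : gT := gplus (x * u).
Definition ract_mp (x u : gT) : gT := gminus (x * u).

Local Open Scope ring_scope.

(** Elements of H, H(x)H, H(x)H(x)H as coefficient functions on the bases
    {g}, {g}(x){h}, {g}(x){h}(x){k}. *)
Definition H1 := gT -> C.
Definition H2 := (gT * gT)%type -> C.
Definition H3 := (gT * gT * gT)%type -> C.

(** {g}{h} = delta_{g_+^{g_-}, h_+} {g h_-}: coefficient of {k} *)
Definition mulc (g h k : gT) : C :=
  ((ract_pm (gplus g) (gminus g) == gplus h) && (k == (g * gminus h)%g))%:R.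

Definition mul1 (a b : H1) : H1 :=
  fun k => \sum_(g : gT) \sum_(h : gT) a g * b h * mulc g h k.
Definition mul2 (a b : H2) : H2 :=
  fun k => \sum_(g : gT * gT) \sum_(h : gT * gT)
             a g * b h * mulc g.1 h.1 k.1 * mulc g.2 h.2 k.2.
Definition mul3 (a b : H3) : H3 :=
  fun k => \sum_(g : gT * gT * gT) \sum_(h : gT * gT * gT)
             a g * b h * mulc g.1.1 h.1.1 k.1.1 * mulc g.1.2 h.1.2 k.1.2
               * mulc g.2 h.2 k.2.

Definition unit1 : H1 := fun k => (k \in Gp)%:R.
Definition unit2 : H2 := fun k => unit1 k.1 * unit1 k.2.
Definition unit3 : H3 := fun k => unit1 k.1.1 * unit1 k.1.2 * unit1 k.2.

(** Delta {g} = sum_{h in G_+} {g_+ h^-1 (^h g_-)} (x) {h g_-}: coefficient of k *)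
Definition deltac (g : gT) (k : gT * gT) : C :=
  \sum_(h in Gp)
    (k == ((gplus g * h^-1 * lact_pm h (gminus g))%g, (h * gminus g)%g))%:R.
Definition coprod (a : H1) : H2 := fun k => \sum_(g : gT) a g * deltac g k.

Definition counit (g : gT) : C := (gplus g == 1%g)%:R.

Definition flip (a : H2) : H2 := fun k => a (k.2, k.1).

Definition coprod_id (R : H2) : H3 :=
  fun k => \sum_(g : gT) R (g, k.2) * deltac g (k.1.1, k.1.2).
Definition id_coprod (R : H2) : H3 :=
  fun k => \sum_(h : gT) R (k.1.1, h) * deltac h (k.1.2, k.2).
Definition R12 (R : H2) : H3 := fun k => R (k.1.1, k.1.2) * unit1 k.2.
Definition R13 (R : H2) : H3 := fun k => R (k.1.1, k.2) * unit1 k.1.2.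
Definition R23 (R : H2) : H3 := fun k => unit1 k.1.1 * R (k.1.2, k.2).
Definition counit_id (R : H2) : H1 := fun k => \sum_(g : gT) counit g * R (g, k).
Definition id_counit (R : H2) : H1 := fun k => \sum_(g : gT) R (k, g) * counit g.

Definition quasi_triangular (R : H2) : Prop :=
  exists Rinv : H2,
    [/\ mul2 R Rinv = unit2 /\ mul2 Rinv R = unit2,
        forall a : H1, flip (coprod a) = mul2 (mul2 R (coprod a)) Rinv,
        coprod_id R = mul3 (R13 R) (R23 R),
        id_coprod R = mul3 (R13 R) (R12 R)
      & counit_id R = unit1 /\ id_counit R = unit1].

Definition positive2 (R : H2) : Prop := forall k, 0 <= R k.

Definition R_of (xi eta : gT -> gT) : H2 :=
  fun k => \sum_(u in Gp) \sum_(v in Gp)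
    (k == ((u * (ract_mp (eta v) u)^-1)%g, (v * xi u)%g))%:R.

Local Close Scope ring_scope.

Definition Gp' (xi : gT -> gT) : {set gT} := [set u * xi u^-1 | u in Gp].
Definition Gp'' (eta : gT -> gT) : {set gT} := [set eta u^-1 * u | u in Gp].

Definition cond_a (xi eta : gT -> gT) : Prop :=
  [/\ group_set (Gp' xi), Gp' xi <| [set: gT],
      group_set (Gp'' eta) & Gp'' eta <| [set: gT]].

Definition cond_b (xi eta : gT -> gT) : Prop :=
  exists F : gT -> gT,
    [/\ forall u, u \in Gp -> F (u * xi u^-1) = eta u * u^-1,
        {in Gp' xi &, {morph F : x y / x * y}},
        {in Gp' xi &, injective F}
      & F @: Gp' xi = Gp'' eta].

End BicrossedHopf.

(* Main.v *)
Require Import Defs.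
From mathcomp Require Import all_boot all_order all_algebra all_fingroup.
From Stdlib Require Import FunctionalExtensionality.

(** Multiplication makes [H(G; G_+, G_-)] the algebra of the action groupoid of [G_-] on
    [G_+]: [{g}] is an arrow from [g_+] to [\bar g_+]. The antipode gives
    [R^{-1} = (S (x) id) R], so a positive [R] has a positive inverse, and nothing cancels in
    their products; hence the support of [R] contains exactly one arrow out of each object
    [(u, v)] of [G_+ x G_+]. The two hexagon identities say how these arrows compose: the
    arrow at [(u, v)] is the pair [(g, h)] with [g_+ = u], [\bar g_- = eta(v)^{-1}],
    [h_+ = v], [h_- = xi(u)] for homomorphisms [xi] and [eta], and its coefficient is a
    positive cocycle in each variable, which averaging over [G_+] forces to be [1].

    For such an [R] the hexagons become [eta(v) u = u' eta(v')] and [v xi(u) = xi(u') v'],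
    with [u' = ^{eta(v)} u] and [v' = v^{xi(u)}], while quasi-cocommutativity becomes
    [v u = u' v'] together with the normalisation of [G_+'] and [G_+''] by [G_-].
    Put [alpha(u) = u xi(u)^{-1}] and [beta(u) = eta(u) u^{-1}]. The three exchange equations
    amount to [v alpha(u) v^{-1} = alpha(u')], [alpha(u') alpha(v) = alpha(v u)] and
    [beta(u') beta(v) = beta(v u)], that is, to normality under [G_+] and to
    [alpha(u) |-> beta(u)] being multiplicative. *)

Section Factorization.
Set Implicit Arguments. Unset Strict Implicit. Unset Printing Implicit Defensive.
Import GRing.Theory Num.Theory.
Local Open Scope group_scope.

Variables (gT : finGroupType) (Gp Gm : {group gT}).
Hypothesis fact : unique_factorization Gp Gm.

Local Notation gplus := (gplus Gp Gm).
Local Notation gminus := (gminus Gp Gm).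
Local Notation bplus := (bplus Gp Gm).
Local Notation bminus := (bminus Gp Gm).

(** * The two factorizations of an element and their projections *)

Lemma factor_eq u v x y : u \in Gp -> v \in Gp -> x \in Gm -> y \in Gm ->
  u * x = v * y -> u = v /\ x = y.
Proof.
move=> uP vP xM yM e; have [p [_ pu]] := fact (u * x).
have /= e1 : p = (u, x) by apply: pu; split.
have /= e2 : p = (v, y) by apply: pu; split.
by move: e1; rewrite e2 => -[].
Qed.

Lemma memGpm g : g \in Gp -> g \in Gm -> g = 1.
Proof.
by move=> gP gM; case: (@factor_eq g 1 1 g) => //; rewrite mulg1 mul1g.
Qed.

Lemma gplus_minus_mem g : gplus g \in Gp /\ gminus g \in Gm.
Proof.
rewrite /Defs.gminus /Defs.gplus; case: pickP => [u /andP[] //|/= none].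
have [[u x] [[/= uP xM e] _]] := fact g.
by have := none u; rewrite uP e mulKg xM.
Qed.

Lemma gplus_mem g : gplus g \in Gp. Proof. by case: (gplus_minus_mem g). Qed.
Lemma gminus_mem g : gminus g \in Gm. Proof. by case: (gplus_minus_mem g). Qed.

Lemma bplus_minus_mem g : bminus g \in Gm /\ bplus g \in Gp.
Proof.
rewrite /Defs.bplus /Defs.bminus; case: pickP => [u /andP[] //|/= none].
have [[u x] [[/= uP xM e] _]] := fact g^-1.
have := none x^-1; rewrite groupV xM invgK -(groupV Gp) invMg e.
by rewrite mulgK uP.
Qed.

Lemma bplus_mem g : bplus g \in Gp. Proof. by case: (bplus_minus_mem g). Qed.
Lemma bminus_mem g : bminus g \in Gm. Proof. by case: (bplus_minus_mem g). Qed.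

Hint Resolve gplus_mem gminus_mem bplus_mem bminus_mem : core.

Lemma gplusK g : gplus g * gminus g = g. Proof. exact: mulKVg. Qed.
Lemma bminusK g : bminus g * bplus g = g. Proof. exact: mulKVg. Qed.

Lemma factorE u x : u \in Gp -> x \in Gm ->
  gplus (u * x) = u /\ gminus (u * x) = x.
Proof. by move=> uP xM; apply: factor_eq => //; rewrite gplusK. Qed.

Lemma gplusM u x : u \in Gp -> x \in Gm -> gplus (u * x) = u.
Proof. by move=> uP /(factorE uP)[]. Qed.

Lemma gminusM u x : u \in Gp -> x \in Gm -> gminus (u * x) = x.
Proof. by move=> uP /(factorE uP)[]. Qed.

(** Inversion exchanges the two factorizations, so uniqueness for one order gives it for the
    other. *)
Lemma bfactorE u x : u \in Gp -> x \in Gm ->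
  bminus (x * u) = x /\ bplus (x * u) = u.
Proof.
move=> uP xM; case: (@factor_eq (bplus (x * u))^-1 u^-1 (bminus (x * u))^-1 x^-1).
all: rewrite ?groupV // -?invMg ?bminusK //.
by move=> /invg_inj-> /invg_inj->.
Qed.

Lemma gplusMl u g : u \in Gp -> gplus (u * g) = u * gplus g.
Proof.
move=> uP; rewrite -{1}(gplusK g) mulgA.
by case: (@factorE (u * gplus g) (gminus g)) => //; rewrite groupM.
Qed.

Lemma gminusMl u g : u \in Gp -> gminus (u * g) = gminus g.
Proof. by move=> uP; rewrite {1}/Defs.gminus gplusMl // invMg mulgA mulgKV. Qed.

Lemma gplusMr x g : x \in Gm -> gplus (g * x) = gplus g.
Proof.
move=> xM; rewrite -{1}(gplusK g) -mulgA.
by case: (@factorE (gplus g) (gminus g * x)) => //; rewrite groupM.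
Qed.

Lemma gminusMr x g : x \in Gm -> gminus (g * x) = gminus g * x.
Proof. by move=> xM; rewrite {1}/Defs.gminus gplusMr // mulgA. Qed.

Lemma bminusMl x g : x \in Gm -> bminus (x * g) = x * bminus g.
Proof.
move=> xM; rewrite -{1}(bminusK g) mulgA.
by case: (@bfactorE (bplus g) (x * bminus g)) => //; rewrite groupM.
Qed.

Lemma bplusMl x g : x \in Gm -> bplus (x * g) = bplus g.
Proof. by move=> xM; rewrite {1}/Defs.bplus bminusMl // invMg mulgA mulgKV. Qed.

Lemma bminusMr u g : u \in Gp -> bminus (g * u) = bminus g.
Proof.
move=> uP; rewrite -{1}(bminusK g) -mulgA.
by case: (@bfactorE (bplus g * u) (bminus g)) => //; rewrite groupM.
Qed.

Lemma gplus1 : gplus 1 = 1.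
Proof. by case: (@factorE 1 1) => //; rewrite mulg1. Qed.

Lemma bminus1 : bminus 1 = 1.
Proof. by case: (@bfactorE 1 1) => //; rewrite mulg1. Qed.

Lemma gplus_id u : u \in Gp -> gplus u = u.
Proof. by move=> uP; rewrite -[u in gplus u]mulg1 gplusMl // gplus1 mulg1. Qed.

Lemma gplus_Gm x : x \in Gm -> gplus x = 1.
Proof. by move=> xM; rewrite -[x]mul1g gplusMr // gplus1. Qed.

Lemma gminus_id x : x \in Gm -> gminus x = x.
Proof. by move=> xM; rewrite /Defs.gminus gplus_Gm // invg1 mul1g. Qed.

Lemma gminus_Gp u : u \in Gp -> gminus u = 1.
Proof. by move=> uP; rewrite /Defs.gminus gplus_id // mulVg. Qed.

Lemma bminus_id x : x \in Gm -> bminus x = x.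
Proof. by move=> xM; rewrite -[x in bminus x]mulg1 bminusMl // bminus1 mulg1. Qed.

Lemma bminus_Gp u : u \in Gp -> bminus u = 1.
Proof. by move=> uP; rewrite -[u]mul1g bminusMr // bminus1. Qed.

Lemma bplus_id u : u \in Gp -> bplus u = u.
Proof. by move=> uP; rewrite /Defs.bplus bminus_Gp // invg1 mul1g. Qed.

Lemma bplus_Gm x : x \in Gm -> bplus x = 1.
Proof. by move=> xM; rewrite /Defs.bplus bminus_id // mulVg. Qed.

Lemma gminus_eq1 g : (gminus g == 1) = (g \in Gp).
Proof.
apply/eqP/idP => [e|/gminus_Gp //].
by rewrite -(gplusK g) e mulg1.
Qed.

Lemma bminus_eq1 g : (bminus g == 1) = (g \in Gp).
Proof.
apply/eqP/idP => [e|/bminus_Gp //].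
by rewrite -(bminusK g) e mul1g.
Qed.

(** The quotient [g^-1 * h] lies in both [Gp] and [Gm], hence is trivial. Thus [gplus] and [bminus]
    together are coordinates on the group. *)
Lemma gplus_bminus_inj g h : gplus g = gplus h -> bminus g = bminus h -> g = h.
Proof.
move=> ep em; apply: (mulgI g^-1); rewrite mulVg; apply/esym/memGpm.
  by rewrite -{1}(bminusK g) -(bminusK h) em invMg mulgA mulgKV groupM ?groupV.
by rewrite -{1}(gplusK g) -(gplusK h) ep invMg mulgA mulgKV groupM ?groupV.
Qed.

Lemma gplus_gminus_inj g h : gplus g = gplus h -> gminus g = gminus h -> g = h.
Proof. by move=> ep em; rewrite -(gplusK g) ep em gplusK. Qed.

(** The element [g] with [g_+ = u] and [\bar g_- = x]. *)
Definition complete u x := x * gplus (x^-1 * u).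

Lemma bminus_complete u x : x \in Gm -> bminus (complete u x) = x.
Proof. by move=> xM; rewrite /complete bminusMl // bminus_Gp // mulg1. Qed.

Lemma completeE u x : complete u x = u * (gminus (x^-1 * u))^-1.
Proof.
by apply: (mulIg (gminus (x^-1 * u))); rewrite mulgKV -mulgA gplusK mulKVg.
Qed.

Lemma gplus_complete u x : u \in Gp -> x \in Gm -> gplus (complete u x) = u.
Proof. by move=> uP xM; rewrite completeE gplusMr ?groupV // gplus_id. Qed.

Lemma bplus_complete u x : x \in Gm -> bplus (complete u x) = gplus (x^-1 * u).
Proof. by move=> xM; rewrite /complete bplusMl // bplus_id. Qed.

Lemma gminus_complete u x : u \in Gp ->
  gminus (complete u x) = (gminus (x^-1 * u))^-1.
Proof. by move=> uP; rewrite completeE gminusMl // gminus_id ?groupV. Qed.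

Lemma completeK g : complete (gplus g) (bminus g) = g.
Proof.
by apply: gplus_bminus_inj; rewrite ?gplus_complete ?bminus_complete.
Qed.

Lemma complete1 x : x \in Gm -> complete 1 x = x.
Proof.
move=> xM; apply: gplus_bminus_inj; first by rewrite gplus_complete // gplus_Gm.
by rewrite bminus_complete // bminus_id.
Qed.

(** The matching condition is the one under which [g] and [h] occur together as the two tensor
    factors of a coproduct, namely that of [gplus g * h]. *)
Lemma bminus_paste g h : gminus g = bminus h -> bminus (gplus g * h) = bminus g.
Proof.
move=> e; have -> : gplus g * h = g * bplus h by rewrite -{2}(gplusK g) e -mulgA bminusK.
by rewrite bminusMr.
Qed.

Lemma gplusV g : gplus g^-1 = (bplus g)^-1.
Proof.
by rewrite -{1}(bminusK g) invMg gplusMr ?groupV // gplus_id ?groupV.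
Qed.

Lemma gminusV g : gminus g^-1 = (bminus g)^-1.
Proof.
by rewrite -{1}(bminusK g) invMg gminusMl ?groupV // gminus_id ?groupV.
Qed.

Lemma bminusV g : bminus g^-1 = (gminus g)^-1.
Proof. by rewrite -[g in RHS]invgK gminusV invgK. Qed.

Lemma mulg_gminus g h : bplus g = gplus h -> g * gminus h = bminus g * h.
Proof. by move=> e; rewrite -{1}(bminusK g) e -mulgA gplusK. Qed.

(** Regard [g] as an arrow from [g_+] to [\bar g_+], so that [{g}{h}] is the composite
    whenever it is nonzero; [ldiv g k] is the arrow [h] with [{g}{h} = {k}]. *)
Definition ldiv (g k : gT) : gT := (bminus g)^-1 * k.

Lemma ldivE g k : gplus g = gplus k -> ldiv g k = bplus g * ((gminus g)^-1 * gminus k).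
Proof.
move=> e; have eg : gplus g = g * (gminus g)^-1 by rewrite -{2}(gplusK g) mulgK.
by rewrite /ldiv -{1}(gplusK k) -e eg /Defs.bplus !mulgA.
Qed.

Lemma gminusVM_mem g k : (gminus g)^-1 * gminus k \in Gm.
Proof. by apply: groupM => //; rewrite groupV. Qed.

Lemma gplus_ldiv g k : gplus g = gplus k -> gplus (ldiv g k) = bplus g.
Proof.
by move=> e; rewrite ldivE // gplusMl // gplus_Gm ?mulg1 // gminusVM_mem.
Qed.

Lemma gminus_ldiv g k : gplus g = gplus k ->
  gminus (ldiv g k) = (gminus g)^-1 * gminus k.
Proof.
by move=> e; rewrite ldivE // gminusMl // gminus_id // gminusVM_mem.
Qed.

Lemma bminus_ldiv g k : bminus (ldiv g k) = (bminus g)^-1 * bminus k.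
Proof. by rewrite bminusMl ?groupV. Qed.

Lemma gplus_comp g h : bplus g = gplus h -> gplus (bminus g * h) = gplus g.
Proof. by move=> e; rewrite -mulg_gminus // gplusMr. Qed.

Lemma gminus_comp g h : bplus g = gplus h -> gminus (bminus g * h) = gminus g * gminus h.
Proof. by move=> e; rewrite -mulg_gminus // gminusMr. Qed.

Lemma ldiv_comp g h : ldiv g (bminus g * h) = h.
Proof. exact: mulKg. Qed.

Lemma comp_ldiv g k : bminus g * ldiv g k = k.
Proof. exact: mulKVg. Qed.

Lemma ldiv_ldiv l g k : ldiv (ldiv l g) (ldiv l k) = ldiv g k.
Proof. by rewrite {1}/ldiv bminus_ldiv invMg invgK -mulgA /ldiv mulKVg. Qed.

Lemma ldiv_compl l h k : ldiv (bminus l * h) k = ldiv h (ldiv l k).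
Proof. by rewrite -(ldiv_ldiv l) ldiv_comp. Qed.

Lemma ldiv_Gp g k : gplus g = gplus k -> (ldiv g k \in Gp) = (g == k).
Proof.
move=> e; rewrite -bminus_eq1 bminus_ldiv -eq_mulVg1.
by apply/eqP/eqP => [/(gplus_bminus_inj e)|->].
Qed.

Lemma ldiv_Gpl g k : g \in Gp -> ldiv g k = k.
Proof. by move=> gP; rewrite /ldiv bminus_Gp // invg1 mul1g. Qed.

(** * Conditions (a) and (b) as exchange and intertwining equations *)

Section Compatibility.
Variables xi eta : {morphism Gp >-> gT}.
Hypothesis xiP : (xi @* Gp \subset Gm)%g.
Hypothesis etaP : (eta @* Gp \subset Gm)%g.

Lemma xi_mem u : u \in Gp -> xi u \in Gm.
Proof. by move=> uP; apply: (subsetP xiP); apply: mem_morphim. Qed.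

Lemma eta_mem u : u \in Gp -> eta u \in Gm.
Proof. by move=> uP; apply: (subsetP etaP); apply: mem_morphim. Qed.

(** With [u' = ^{eta v} u] and [v' = v^{xi u}], the next three conditions read
    [eta(v) u = u' eta(v')], [v xi(u) = xi(u') v'] and [v u = u' v']. *)
Definition exchange_eta := forall u v, u \in Gp -> v \in Gp ->
  gminus (eta v * u) = eta (bplus (v * xi u)).
Definition exchange_xi := forall u v, u \in Gp -> v \in Gp ->
  bminus (v * xi u) = xi (gplus (eta v * u)).
Definition exchange_id := forall u v, u \in Gp -> v \in Gp ->
  v * u = gplus (eta v * u) * bplus (v * xi u).
Definition intertwines (f : gT -> gT) := forall u z, u \in Gp -> z \in Gm ->
  f u * z = bminus (u * z) * f (bplus (u * z)).

(** [F] maps [al u] to [be u]. *)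
Let al u := u * (xi u)^-1.
Let be u := eta u * u^-1.

Lemma mem_Gp' x : reflect (exists2 u, u \in Gp & x = al u) (x \in Gp' Gp xi).
Proof.
by apply: (iffP imsetP) => -[u uP ->]; exists u => //; rewrite /al morphV.
Qed.

Lemma mem_Gp'' x : reflect (exists2 u, u \in Gp & x = be u) (x \in Gp'' Gp eta).
Proof.
by apply: (iffP imsetP) => -[u uP ->]; exists u^-1; rewrite ?groupV // /be ?invgK.
Qed.

Lemma conj_normal (N : {set gT}) x g : N <| [set: gT] -> x \in N -> g * x * g^-1 \in N.
Proof.
move=> /andP[_ /subsetP nN] xN; have /normP <- := nN g^-1 (in_setT _).
by rewrite -[g * x * _]mulgA -{1}(invgK g) memJ_conjg.
Qed.

(** Conjugation of [al u] by [v] stays in [Gp'] and so produces [u']; then [v u = u' v'] forces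
    [v']. Multiplicativity of [F] carries the relation for [xi] over to [eta], and conjugation by
    [Gm] gives the intertwining relations. *)
Lemma cond_ab_compat : cond_a Gp xi eta -> cond_b Gp xi eta ->
  [/\ exchange_eta, exchange_xi, exchange_id, intertwines xi & intertwines eta].
Proof.
case=> G1 N1 G2 N2 [F [Fal FM _ _]].
have Fa u : u \in Gp -> F (al u) = be u by move=> uP; rewrite /al -morphV // Fal.
have alP u : u \in Gp -> al u \in Gp' Gp xi by move=> uP; apply/mem_Gp'; exists u.
have beP u : u \in Gp -> be u \in Gp'' Gp eta by move=> uP; apply/mem_Gp''; exists u.
have key u v : u \in Gp -> v \in Gp -> exists u' v', [/\ u' \in Gp, v' \in Gp,
   v * u = u' * v', v * xi u = xi u' * v' & eta v * u = u' * eta v'].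
  move=> uP vP; have /mem_Gp'[u' u'P e] := conj_normal v N1 (alP u uP).
  pose v' := u'^-1 * (v * u).
  have v'P : v' \in Gp by rewrite !groupM ?groupV.
  have e3 : v * u = u' * v' by rewrite mulKVg.
  have e2 : v * xi u = xi u' * v'.
    have -> : v' = u'^-1 * (v * al u * v^-1) * v * xi u.
      by rewrite /al /v' !mulgA !mulgKV.
    by rewrite e /al !mulgA mulgKV mulgV mul1g.
  exists u', v'; split=> //.
  (* Apply [F] to this product: cancelling the common factor [eta u'] from the image leaves the
     exchange for [eta]. *)
  have alM : al u' * al v = al (v * u).
    rewrite /al [in RHS]morphM // invMg [in RHS]e3 !mulgA; congr (_ * _).
    apply: (mulIg (xi u)); rewrite mulgKV -!mulgA e2 mulKg //.
  have := FM _ _ (alP _ u'P) (alP _ vP).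
  rewrite alM !Fa ?groupM // /be {1}e3 morphM // invMg -!mulgA.
  move/mulgI/(congr1 (fun x => u' * (x * (v * u)))).
  by rewrite !mulgA mulgV mul1g !mulgKV => <-.
(* The displayed equation exhibits [f u * z * (f w)^-1] and [w] as the two factors of [u * z], from
   which the relation is read off. *)
have inter (f : {morphism Gp >-> gT}) : {in Gp, forall u, f u \in Gm} ->
   (forall u z, u \in Gp -> z \in Gm ->
      exists2 w, w \in Gp & u * z = f u * z * (f w)^-1 * w) -> intertwines f.
  move=> fM H u z uP zM; have [w wP ->] := H u z uP zM.
  by rewrite bminusMl ?bplusMl ?bminus_Gp ?bplus_id ?mulg1 ?mulgKV ?groupM ?groupV ?fM.
split.
- move=> u v uP vP; have [u' [v' [u'P v'P _ -> ->]]] := key u v uP vP.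
  by rewrite bplusMl ?xi_mem // bplus_id // gminusMl // gminus_id ?eta_mem.
- move=> u v uP vP; have [u' [v' [u'P v'P _ -> ->]]] := key u v uP vP.
  by rewrite bminusMr // bminus_id ?xi_mem // gplusMr ?eta_mem // gplus_id.
- move=> u v uP vP; have [u' [v' [u'P v'P -> -> ->]]] := key u v uP vP.
  by rewrite bplusMl ?xi_mem // bplus_id // gplusMr ?eta_mem // gplus_id.
- apply: inter => [u|u z uP zM]; first exact: xi_mem.
  (* Conjugating [al u^-1] by [z^-1] gives some [al w]; inverting this equation shows that the
     required element is [w^-1]. *)
  have /mem_Gp'[w wP] : z^-1 * al u^-1 * z^-1^-1 \in Gp' Gp xi.
    by apply: conj_normal => //; rewrite alP ?groupV.
  rewrite /al morphV // !invgK => e; exists w^-1; rewrite ?groupV //.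
  have eV : xi w * w^-1 = (z^-1 * (u^-1 * xi u) * z)^-1 by rewrite e invMg invgK.
  rewrite morphV // invgK -mulgA eV !invMg !invgK !mulgA.
  by rewrite mulgK mulgV mul1g.
- apply: inter => [u|u z uP zM]; first exact: eta_mem.
  have /mem_Gp''[w wP] : z^-1 * be u^-1 * z^-1^-1 \in Gp'' Gp eta.
    by apply: conj_normal => //; rewrite beP ?groupV.
  rewrite /be morphV // !invgK => e; exists w^-1; rewrite ?groupV //.
  by rewrite morphV // invgK -mulgA -e !mulgA mulgK mulgV mul1g.
Qed.

(** The exchange equations express a product of two elements [al] (or [be]) as a third, with the
    same index [v * u] on both sides. This gives closure, and makes the map from [al u] to [be u]
    multiplicative. *)
Lemma compat_cond_ab :
  exchange_eta -> exchange_xi -> exchange_id -> intertwines xi -> intertwines eta ->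
  cond_a Gp xi eta /\ cond_b Gp xi eta.
Proof.
move=> h1 h2 h3 hx he.
have alP u : u \in Gp -> al u \in Gp' Gp xi by move=> uP; apply/mem_Gp'; exists u.
have beP u : u \in Gp -> be u \in Gp'' Gp eta by move=> uP; apply/mem_Gp''; exists u.
(* Each [eta v] permutes [Gp] by its left action, so [u'] can be prescribed as [t], with [u] its
   preimage. *)
have key t v : t \in Gp -> v \in Gp -> exists u w, [/\ u \in Gp, w \in Gp,
    v * u = t * w, v * xi u = xi t * w & eta v * u = t * eta w].
  move=> tP vP; pose u := gplus ((eta v)^-1 * t).
  have eu : gplus (eta v * u) = t.
    have -> : eta v * u = t * (gminus ((eta v)^-1 * t))^-1.
      have -> : u = (eta v)^-1 * t * (gminus ((eta v)^-1 * t))^-1.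
        by apply: (canRL (mulgK _)); exact: gplusK.
      by rewrite !mulgA mulgV mul1g.
    by rewrite gplusMr ?groupV // gplus_id.
  have uP : u \in Gp by exact: gplus_mem.
  exists u, (bplus (v * xi u)); split=> //.
  - by rewrite h3 // eu.
  - by rewrite -{1}(bminusK (v * xi u)) h2 // eu.
  - by rewrite -{1}(gplusK (eta v * u)) h1 // eu.
have alM t v u w : u \in Gp -> w \in Gp -> t \in Gp -> v \in Gp ->
    v * u = t * w -> v * xi u = xi t * w -> al t * al v = al (v * u).
  move=> uP wP tP vP e3 e2; rewrite /al [in RHS]morphM // invMg [in RHS]e3 !mulgA.
  congr (_ * _); apply: (mulIg (xi u)); rewrite mulgKV -!mulgA e2 mulKg //.
have beM t v u w : u \in Gp -> w \in Gp -> t \in Gp -> v \in Gp ->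
    v * u = t * w -> eta v * u = t * eta w -> be t * be v = be (v * u).
  move=> uP wP tP vP e3 e1; rewrite /be {1}e3 morphM // invMg -!mulgA; congr (_ * _).
  by apply: (mulgI t); rewrite mulKVg !mulgA -e1 mulgK.
have al1 : 1 \in Gp' Gp xi.
  by have := alP 1 (group1 _); rewrite /al morph1 invg1 mulg1.
have be1 : 1 \in Gp'' Gp eta.
  by have := beP 1 (group1 _); rewrite /be morph1 invg1 mulg1.
have g1 : group_set (Gp' Gp xi).
  apply/group_setP; split=> // x y /mem_Gp'[t tP ->] /mem_Gp'[v vP ->].
  have [u [w [uP wP e3 e2 _]]] := key t v tP vP.
  by rewrite (alM t v u w) // alP ?groupM.
have g2 : group_set (Gp'' Gp eta).
  apply/group_setP; split=> // x y /mem_Gp''[t tP ->] /mem_Gp''[v vP ->].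
  have [u [w [uP wP e3 _ e1]]] := key t v tP vP.
  by rewrite (beM t v u w) // beP ?groupM.
(* Every element is a product of one from [Gp] and one from [Gm], so it suffices to conjugate by
   each factor separately. *)
have normalI (N : {set gT}) : group_set N ->
    (forall x u, x \in N -> u \in Gp -> x ^ u \in N) ->
    (forall x z, x \in N -> z \in Gm -> x ^ z \in N) -> N <| [set: gT].
  move=> gN HP HM; rewrite /normal subsetT /=; apply/subsetP=> g _.
  rewrite inE; apply/subsetP=> _ /imsetP[x xN ->].
  by rewrite -(gplusK g) conjgM HM ?HP.
have n1 : Gp' Gp xi <| [set: gT].
  apply: normalI => // _ g /mem_Gp'[u uP ->] gP.
    pose v := g^-1; have vP : v \in Gp by rewrite groupV.
    have -> : al u ^ g = al (gplus (eta v * u)).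
      rewrite /conjg -[in X in _ * X](invgK g) -/v mulgA; apply: (canLR (mulgK _)).
      have -> : al (gplus (eta v * u)) * v
              = gplus (eta v * u) * (bplus (v * xi u) * (xi u)^-1).
        rewrite /al -mulgA -h2 //; congr (_ * _).
        by apply: (canLR (mulKg _)); rewrite mulgA bminusK mulgK.
      by rewrite [RHS]mulgA -h3 // [LHS]mulgA.
    exact: alP.
  have := hx u^-1 g; rewrite groupV morphV // => /(_ uP gP) e.
  have -> : al u ^ g = al (bplus (u^-1 * g))^-1; last by rewrite alP ?groupV.
  rewrite /conjg /al morphV // invgK -mulgA e mulgA.
  have -> : g^-1 * u = (bminus (u^-1 * g) * bplus (u^-1 * g))^-1.
    by rewrite bminusK invMg invgK.
  by rewrite invMg -mulgA mulKg.
have n2 : Gp'' Gp eta <| [set: gT].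
  apply: normalI => // _ g /mem_Gp''[u uP ->] gP.
    (* Prescribing [g] as the left factor gives [u * t = g * w] and [eta u * t = g * eta w];
       eliminating [t] yields the conjugate. *)
    have [t [w [tP wP e3 _ e1]]] := key g u gP uP.
    have -> : be u ^ g = be w; last exact: beP.
    rewrite /conjg /be; apply: (mulgI g); rewrite mulKVg mulgA -e1.
    by apply: (mulIg w); rewrite mulgKV -!mulgA -e3 mulKg.
  have := he u^-1 g; rewrite groupV morphV // => /(_ uP gP) e.
  have -> : be u ^ g = be (bplus (u^-1 * g))^-1; last by rewrite beP ?groupV.
  rewrite /conjg /be morphV // invgK.
  have -> : g^-1 * (eta u * u^-1 * g) = g^-1 * eta u * (u^-1 * g) by rewrite !mulgA.
  have -> : g^-1 * eta u = (bminus (u^-1 * g) * eta (bplus (u^-1 * g)))^-1.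
    by rewrite -e invMg invgK.
  by rewrite invMg -mulgA.
have gal u : u \in Gp -> gplus (al u) = u.
  by move=> uP; rewrite /al gplusMr ?groupV ?xi_mem // gplus_id.
split=> //.
(* The index [u] is recovered from [al u] as its plus part. *)
exists (fun g => be (gplus g)); split.
- move=> u uP; rewrite gplusMr ?gplus_id // xi_mem ?groupV //.
- move=> _ _ /mem_Gp'[t tP ->] /mem_Gp'[v vP ->].
  have [u [w [uP wP e3 e2 e1]]] := key t v tP vP.
  by rewrite (alM t v u w) // !gal ?groupM // (beM t v u w).
- move=> _ _ /mem_Gp'[t tP ->] /mem_Gp'[v vP ->].
  rewrite !gal // => e.
  (* The opposite plus part of [be t] is [t^-1], so [be] determines its index. *)
  suff /invg_inj-> : t^-1 = v^-1 by [].
  rewrite -[LHS]bplus_id ?groupV // -[RHS]bplus_id ?groupV //.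
  rewrite -(@bplusMl (eta t)) ?eta_mem // -[RHS](@bplusMl (eta v)) ?eta_mem //.
  by congr bplus.
- apply/setP=> x; apply/imsetP/mem_Gp''.
    by case=> _ /mem_Gp'[t tP ->] ->; exists t; rewrite ?gal.
  case=> u uP ->; exists (al u); first exact: alP.
  by rewrite gal.
Qed.

End Compatibility.

(** * Hopf algebra operations on coefficient functions *)

Section Algebra.
Variable C : numClosedFieldType.
Local Open Scope ring_scope.

(** Solving for [h] instead of [k] leaves at most one right factor for given [g] and [k], so
    products become single sums over arrows out of the source of [k]. *)
Lemma mulcE g h k :
  mulc Gp Gm C g h k = ((gplus g == gplus k) && (h == ldiv g k))%:R.
Proof.
rewrite /mulc /ract_pm gplusK; congr (_%:R); congr nat_of_bool.
apply/andP/andP=> [] [/eqP e1 /eqP e2].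
  by rewrite e2 gplusMr // mulg_gminus // ldiv_comp !eqxx.
by rewrite e2 gplus_ldiv // eqxx mulg_gminus ?comp_ldiv // gplus_ldiv.
Qed.

(** The summation index is forced to be [gplus k.2], so at most one term survives. *)
Lemma deltacE g k :
  deltac Gp Gm C g k = ((gminus k.1 == bminus k.2) && (g == (gplus k.1 * k.2)%g))%:R.
Proof.
rewrite /deltac.
have H h : h \in Gp -> (k == (gplus g * h^-1 * lact_pm Gp Gm h (gminus g), h * gminus g)%g)
   = (h == gplus k.2) && ((gminus k.1 == bminus k.2) && (g == gplus k.1 * k.2)%g).
  case: k => a b hP; rewrite xpair_eqE /= /lact_pm.
  apply/andP/and3P => [[/eqP-> /eqP->]|[/eqP-> /eqP e /eqP->]].
    rewrite (gplusMr _ (gminus_mem _)) (gplus_id hP) gplusMr // gminusMl ?groupM ?groupV //.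
    rewrite gplus_id ?groupM ?groupV // gminus_id //.
    by rewrite -mulgA mulKg gplusK !eqxx.
  rewrite gplusMl // gminusMl // mulgK gplusK -e gplusK; split; exact: eqxx.
under eq_bigr => h hP do rewrite H //.
rewrite (bigD1 (gplus k.2)) //= eqxx /= big1 ?addr0 // => h /andP[_ /negbTE->] //.
Qed.

Definition src2 (g : gT * gT) := (gplus g.1, gplus g.2).
Definition ldiv2 (g k : gT * gT) := (ldiv g.1 k.1, ldiv g.2 k.2).

Lemma sum_and_delta (T : finType) (F : T -> C) (b : bool) (x : T) :
  \sum_g F g * (b && (g == x))%:R = b%:R * F x.
Proof.
rewrite (bigD1 x) //= eqxx andbT big1 ?addr0 => [|g /negbTE->]; first by rewrite mulrC.
by rewrite andbF mulr0.
Qed.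

Lemma mul2E (a b : H2 gT C) k :
  mul2 Gp Gm a b k = \sum_(g | src2 g == src2 k) a g * b (ldiv2 g k).
Proof.
rewrite /mul2 [RHS]big_mkcond; apply: eq_bigr => g _.
have := sum_and_delta (fun h => a g * b h) (src2 g == src2 k) (ldiv2 g k).
rewrite mulr_natl mulrb => <-; apply: eq_bigr => h _; rewrite -mulrA !mulcE -natrM mulnb.
by rewrite andbACA [h == _]xpair_eqE.
Qed.

Lemma mul3E (a b : H3 gT C) k : mul3 Gp Gm a b k =
  \sum_(g | (src2 g.1 == src2 k.1) && (gplus g.2 == gplus k.2))
     a g * b (ldiv2 g.1 k.1, ldiv g.2 k.2).
Proof.
rewrite /mul3 [RHS]big_mkcond; apply: eq_bigr => g _.
have := sum_and_delta (fun h => a g * b h)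
  ((src2 g.1 == src2 k.1) && (gplus g.2 == gplus k.2)) (ldiv2 g.1 k.1, ldiv g.2 k.2).
rewrite mulr_natl mulrb => <-; apply: eq_bigr => h _.
rewrite -!mulrA !mulcE -!natrM !mulnb; congr (_ * (_ * (nat_of_bool _)%:R)).
rewrite [h == _]xpair_eqE [h.1 == _]xpair_eqE [src2 _ == _]xpair_eqE.
by do 6!case: (_ == _).
Qed.

(** The unit factors force the first arrow to be all of [k1] in the first slot and an identity in
    the second; only the third slot is still summed. *)
Lemma mul_R13_R23E (R : H2 gT C) k1 k2 k3 :
  mul3 Gp Gm (R13 Gp R) (R23 Gp R) (k1, k2, k3) =
  \sum_(g | gplus g == gplus k3) R (k1, g) * R (k2, ldiv g k3).
Proof.
rewrite mul3E (bigID (fun g => g.1 == (k1, gplus k2))) /= addrC big1 ?add0r.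
  rewrite (reindex_onto (fun x => (k1, gplus k2, x)) (fun g => g.2)) /=; last first.
    by move=> [g1 g2] /andP[_ /eqP /= <-].
  apply: eq_big => [x|x /andP[/andP[/andP[_ /eqP e] _] _]].
    by rewrite /src2 /= (gplus_id (gplus_mem k2)) !eqxx !andbT.
  rewrite /R13 /R23 /unit1 /= gplus_mem mulr1 ldiv_Gp // eqxx mul1r.
  by rewrite (ldiv_Gpl _ (gplus_mem k2)).
move=> [[g1 g2] g3] /andP[/andP[]] /=; rewrite !xpair_eqE => /andP[/eqP e1 /eqP e2] /eqP e3.
rewrite /R13 /R23 /unit1 /= ldiv_Gp //; case: (g1 =P k1) => //= _; last first.
  by rewrite mul0r mulr0.
case: (boolP (g2 \in Gp)) => [gP|_ _]; last by rewrite mulr0 mul0r.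
by rewrite -[gplus k2]e2 gplus_id ?eqxx.
Qed.

Lemma mul_R13_R12E (R : H2 gT C) k1 k2 k3 :
  mul3 Gp Gm (R13 Gp R) (R12 Gp R) (k1, k2, k3) =
  \sum_(g | gplus g == gplus k1) R (g, k3) * R (ldiv g k1, k2).
Proof.
rewrite mul3E (bigID (fun g => (g.1.2 == gplus k2) && (g.2 == k3))) /= addrC big1 ?add0r.
  rewrite (reindex_onto (fun x => (x, gplus k2, k3)) (fun g => g.1.1)) /=; last first.
    by move=> [[g1 g2] g3] /andP[_ /andP[/eqP /= <- /eqP <-]].
  apply: eq_big => [x|x /andP[/andP[/andP[_ /eqP e] _] _]].
    by rewrite /src2 /= xpair_eqE (gplus_id (gplus_mem k2)) !eqxx !andbT.
  rewrite /R13 /R12 /unit1 /= gplus_mem mulr1 ldiv_Gp // eqxx mulr1.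
  by rewrite (ldiv_Gpl _ (gplus_mem k2)).
move=> [[g1 g2] g3] /andP[/andP[]] /=; rewrite !xpair_eqE => /andP[/eqP e1 /eqP e2] /eqP e3.
rewrite /R13 /R12 /unit1 /= ldiv_Gp //; case: (g3 =P k3) => //= _; last by rewrite !mulr0.
case: (boolP (g2 \in Gp)) => [gP|_ _]; last by rewrite mulr0 mul0r.
by rewrite -[gplus k2]e2 gplus_id ?eqxx.
Qed.

Lemma coprodE (a : H1 gT C) k :
  coprod Gp Gm a k = (gminus k.1 == bminus k.2)%:R * a (gplus k.1 * k.2)%g.
Proof.
by rewrite /coprod -sum_and_delta; apply: eq_bigr => g _; rewrite deltacE.
Qed.

Lemma coprod_idE (R : H2 gT C) k1 k2 k3 : coprod_id Gp Gm R (k1, k2, k3) =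
  (gminus k1 == bminus k2)%:R * R ((gplus k1 * k2)%g, k3).
Proof. exact: (coprodE (fun g => R (g, k3)) (k1, k2)). Qed.

Lemma id_coprodE (R : H2 gT C) k1 k2 k3 : id_coprod Gp Gm R (k1, k2, k3) =
  (gminus k2 == bminus k3)%:R * R (k1, (gplus k2 * k3)%g).
Proof. exact: (coprodE (fun g => R (k1, g)) (k2, k3)). Qed.

Lemma gplus_eq1 g : (gplus g == 1%g) = (g \in Gm).
Proof.
apply/eqP/idP => [e|/gplus_Gm //].
by rewrite -(gplusK g) e mul1g.
Qed.

Lemma counit_idE (R : H2 gT C) k : counit_id Gp Gm R k = \sum_(g in Gm) R (g, k).
Proof.
rewrite /counit_id [RHS]big_mkcond; apply: eq_bigr => g _.
by rewrite /counit gplus_eq1 mulr_natl mulrb.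
Qed.

Lemma id_counitE (R : H2 gT C) k : id_counit Gp Gm R k = \sum_(g in Gm) R (k, g).
Proof.
rewrite /id_counit [RHS]big_mkcond; apply: eq_bigr => g _.
by rewrite /counit gplus_eq1 mulr_natr mulrb.
Qed.

(** The identity [coprod_id R = mul3 (R13 R) (R23 R)] in coefficients. *)
Definition hexagon_l (R : H2 gT C) := forall k1 k2 k3,
  (gminus k1 == bminus k2)%:R * R ((gplus k1 * k2)%g, k3) =
  \sum_(g | gplus g == gplus k3) R (k1, g) * R (k2, ldiv g k3).

(** The identity [id_coprod R = mul3 (R13 R) (R12 R)] in coefficients. *)
Definition hexagon_r (R : H2 gT C) := forall k1 k2 k3,
  (gminus k2 == bminus k3)%:R * R (k1, (gplus k2 * k3)%g) =
  \sum_(g | gplus g == gplus k1) R (g, k3) * R (ldiv g k1, k2).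

(** The antipode applied to the first tensor factor: it inverts basis elements, so coefficients are
    read at the inverse. *)
Definition antipode_id (R : H2 gT C) : H2 gT C := fun k => R (k.1^-1%g, k.2).

Lemma mul2_pairE (a b : H2 gT C) k1 k2 :
  mul2 Gp Gm a b (k1, k2) =
  \sum_(g | gplus g == gplus k1) \sum_(h | gplus h == gplus k2)
     a (g, h) * b (ldiv g k1, ldiv h k2).
Proof.
rewrite mul2E pair_big_dep /=; apply: eq_big => [[g h]|[g h] _] //=.
Qed.

(** * The inverse of [R] from the antipode *)

Section Antipode.
Variable R : H2 gT C.
Hypothesis hex : hexagon_l R.
Hypothesis cou : counit_id Gp Gm R = unit1 Gp C.

(** This is the antipode axiom in the first factor: the hexagon collapses the inner sum to one
    coefficient of [R], its delta says [k1 \in Gp], and the sum left over [Gm] is the counit applied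
    to [R]. *)
Lemma antipode_mul : mul2 Gp Gm (antipode_id R) R = unit2 Gp C.
Proof.
apply: functional_extensionality => -[k1 k2]; rewrite mul2_pairE /unit2 /=.
have := congr1 (@^~ k2) cou; rewrite /= counit_idE => <-.
under eq_bigr => g _ do rewrite /antipode_id /= -hex gminusV bminus_ldiv
  -{1}[(bminus g)^-1%g]mulg1 (inj_eq (mulgI _)) eq_sym bminus_eq1.
rewrite -mulr_sumr /unit1; case: (boolP (k1 \in Gp)) => [kP|_]; last by rewrite !mul0r.
(* The first argument of [R] simplifies to [g^-1 * k1], which runs over [Gm]. *)
rewrite !mul1r (reindex_onto (fun g => k1 * g^-1)%g (fun g => g^-1 * k1)%g) /=; last first.
  by move=> g _; rewrite invMg invgK mulKVg.
apply: eq_big => [g|g _].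
  rewrite gplusMl // (gplus_id kP) -{2}[k1]mulg1 (inj_eq (mulgI _)) gplus_eq1 groupV.
  by rewrite invMg invgK mulgKV eqxx andbT.
by congr (R (_, _)); rewrite gplusV /ldiv mulgA -invMg bminusK invMg invgK mulgKV.
Qed.

Lemma mul_antipode : mul2 Gp Gm R (antipode_id R) = unit2 Gp C.
Proof.
apply: functional_extensionality => -[k1 k2]; rewrite mul2_pairE /unit2 /=.
have := congr1 (@^~ k2) cou; rewrite /= counit_idE => <-.
under eq_bigr => g /eqP e do rewrite /antipode_id /= -hex bminusV (gminus_ldiv e)
  invMg invgK -{1}[gminus g]mul1g (inj_eq (mulIg _)) eq_sym eq_invg1 gminus_eq1.
rewrite -mulr_sumr /unit1; case: (boolP (k1 \in Gp)) => [kP|_]; last by rewrite !mul0r.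
(* In this order the first argument simplifies to [bminus g], which parametrizes the arrows out of
   [k1]. *)
rewrite !mul1r (reindex_onto (complete k1) bminus) /=; last first.
  move=> g /eqP e; apply: gplus_bminus_inj; last by rewrite bminus_complete.
  by rewrite gplus_complete // e gplus_id.
apply: eq_big => [g|g /andP[_ /eqP eg]].
  case: (boolP (g \in Gm)) => gM.
    by rewrite bminus_complete ?gplus_complete ?gplus_id ?eqxx.
  by apply/negbTE; apply: contra gM => /andP[_ /eqP <-].
have gM : g \in Gm by rewrite -eg.
rewrite gplus_complete //; congr (R (_, _)).
by rewrite /ldiv eg invMg invgK mulKVg.
Qed.

End Antipode.

Lemma mul2A (a b c : H2 gT C) :
  mul2 Gp Gm (mul2 Gp Gm a b) c = mul2 Gp Gm a (mul2 Gp Gm b c).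
Proof.
apply: functional_extensionality => k; rewrite !mul2E.
under eq_bigr => g _ do rewrite mul2E mulr_suml.
rewrite (exchange_big_dep (fun l => src2 l == src2 k)) /=; last by move=> g l /eqP-> /eqP->.
apply: eq_bigr => l /eqP lk; rewrite mul2E mulr_sumr.
(* Each [g] is written as the composite of [l] with an arrow [h]. *)
rewrite (reindex_onto (fun h => (bminus l.1 * h.1, bminus l.2 * h.2)%g) (ldiv2 l)) /=.
  move: lk => [lk1 lk2]; apply: eq_big => [[h1 h2]|[h1 h2] _].
    rewrite /ldiv2 /= !ldiv_comp eqxx andbT /src2 /= !xpair_eqE /= -lk1 -lk2.
    have H (x y : gT) : (gplus (bminus x * y)%g == gplus x) = (bplus x == gplus y).
      apply/eqP/eqP => [/esym e|]; last exact: gplus_comp.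
      by rewrite -(gplus_ldiv e) ldiv_comp.
    rewrite (eq_sym (gplus l.1)) (eq_sym (gplus l.2)) !H !gplus_ldiv //.
    by rewrite (eq_sym (gplus h1)) (eq_sym (gplus h2)) andbb.
  by rewrite /ldiv2 /= !ldiv_compl !ldiv_comp -mulrA.
by move=> [g1 g2] _; rewrite /ldiv2 /= !comp_ldiv.
Qed.

Lemma unit2_ldiv g k : src2 g = src2 k -> unit2 Gp C (ldiv2 g k) = (g == k)%:R.
Proof.
case: g k => [g1 g2] [k1 k2] [e1 e2].
by rewrite /unit2 /unit1 /= !ldiv_Gp // -natrM mulnb xpair_eqE.
Qed.

Lemma mul2_unit (a : H2 gT C) : mul2 Gp Gm a (unit2 Gp C) = a.
Proof.
apply: functional_extensionality => k; rewrite mul2E (bigD1 k) //= unit2_ldiv // eqxx mulr1.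
by rewrite big1 ?addr0 // => g /andP[/eqP e /negbTE ne]; rewrite unit2_ldiv // ne mulr0.
Qed.

(** The hexagon and the counit supply the inverse through [antipode_id], so it can be eliminated by
    moving it across the conjugation equation. *)
Lemma quasi_triangularP (R : H2 gT C) : quasi_triangular Gp Gm R <->
  [/\ hexagon_l R, hexagon_r R, counit_id Gp Gm R = unit1 Gp C,
      id_counit Gp Gm R = unit1 Gp C
    & forall a, mul2 Gp Gm (flip (coprod Gp Gm a)) R = mul2 Gp Gm R (coprod Gp Gm a)].
Proof.
split=> [[R' [[RR' R'R] cc hl hr [cl cr]]]|[hl hr cl cr cc]].
  split=> // [k1 k2 k3|k1 k2 k3|a].
  - by rewrite -coprod_idE hl mul_R13_R23E.
  - by rewrite -id_coprodE hr mul_R13_R12E.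
  - by rewrite cc mul2A R'R mul2_unit.
exists (antipode_id R); split=> // [|a||].
- by rewrite antipode_mul // mul_antipode.
- by rewrite -cc mul2A mul_antipode // mul2_unit.
- by apply: functional_extensionality => -[[k1 k2] k3]; rewrite coprod_idE hl mul_R13_R23E.
- by apply: functional_extensionality => -[[k1 k2] k3]; rewrite id_coprodE hr mul_R13_R12E.
Qed.

(** * Invertible elements with non-negative coefficients *)

Lemma nonneg_sum_neq0 (T : finType) (P : pred T) (F : T -> C) x :
  (forall i, P i -> 0 <= F i) -> P x -> F x != 0 -> \sum_(i | P i) F i != 0.
Proof.
move=> F0 Px; apply: contra_neq => s0.
by have /(_ x Px) := psumr_eq0P F0 s0.
Qed.

(** Nothing cancels in a product of nonnegative elements, so every composable pair from
    the supports of [b] and [a] is an identity. *)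
Lemma nonneg_inverse_bisection (a b : H2 gT C) : positive2 a -> positive2 b ->
  mul2 Gp Gm a b = unit2 Gp C -> mul2 Gp Gm b a = unit2 Gp C ->
  forall u v, u \in Gp -> v \in Gp ->
  exists2 g, src2 g = (u, v) /\ a g != 0 &
    forall h, src2 h = (u, v) -> a h != 0 -> h = g.
Proof.
move=> a0 b0 ab ba u v uP vP.
have : mul2 Gp Gm a b (u, v) != 0.
  by rewrite ab /unit2 /unit1 /= uP vP mulr1 oner_eq0.
rewrite mul2E => /eqP; case: (pickP (fun g => (src2 g == src2 (u, v))
   && (a g * b (ldiv2 g (u, v)) != 0))) => [g /andP[/eqP e]|none]; last first.
  by case; apply: big1 => g eg; apply/eqP; have := none g; rewrite eg => /negbFE.
rewrite mulf_eq0 negb_or => /andP[ag bg] _.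
have e' : src2 g = (u, v) by rewrite e /src2 /= !gplus_id.
exists g => // h eh ah.
(* The arrow of [b] returning from [g], followed by [h], composes to [ldiv2 g h]; being in the
   support of the unit it is an identity, so [g] and [h] agree. *)
have : mul2 Gp Gm b a (ldiv2 g h) != 0.
  rewrite mul2E; apply: (nonneg_sum_neq0 (x := ldiv2 g (u, v))) => [l _||].
  - by rewrite mulr_ge0 ?a0 ?b0.
  - move: eh e' e => [<- <-] [e1 e2] [e3 e4].
    by rewrite /ldiv2 /src2 /= !gplus_ldiv.
  - rewrite mulf_neq0 // /ldiv2 /= !ldiv_ldiv !ldiv_Gpl //.
    by rewrite -surjective_pairing.
rewrite ba unit2_ldiv; last by rewrite e' eh.
by case: (g =P h) => // _; rewrite eqxx.
Qed.

(** * The axioms for [R_of xi eta] as equations on [xi] and [eta] *)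

Section Bisection.
Variables xi eta : {morphism Gp >-> gT}.
Hypothesis xiP : (xi @* Gp \subset Gm)%g.
Hypothesis etaP : (eta @* Gp \subset Gm)%g.
Let xiM := xi_mem xiP.
Let etaM := eta_mem etaP.

Local Notation R := (R_of Gp Gm C xi eta).

(** [u (eta(v)^u)^-1] is the element with plus part [u] and opposite minus part
    [eta(v)^-1], whence this symmetric form of the coefficients. *)
Lemma R_ofE k1 k2 : R (k1, k2) =
  ((bminus k1 == (eta (gplus k2))^-1%g) && (gminus k2 == xi (gplus k1)))%:R.
Proof.
have H u v : u \in Gp -> v \in Gp ->
    ((k1, k2) == ((u * (ract_mp Gp Gm (eta v) u)^-1)%g, (v * xi u)%g)) =
    [&& u == gplus k1, v == gplus k2 &
      (bminus k1 == (eta (gplus k2))^-1%g) && (gminus k2 == xi (gplus k1))].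
  move=> uP vP; have -> : (u * (ract_mp Gp Gm (eta v) u)^-1)%g = complete u (eta v)^-1.
    rewrite -[RHS]gplusK gplus_complete ?groupV ?etaM //.
    by rewrite gminus_complete // invgK.
  rewrite xpair_eqE; apply/andP/and4P => [[/eqP-> /eqP->]|[/eqP-> /eqP-> /eqP e1 /eqP e2]].
    rewrite gplus_complete ?bminus_complete ?groupV ?etaM //.
    by rewrite gplusMr ?gminusMl ?gplus_id ?gminus_id ?xiM.
  by rewrite -e1 completeK -e2 gplusK.
rewrite /R_of (bigD1 (gplus k1)) // [X in _ + X = _]big1; last first.
  by move=> u /andP[uP /negbTE nu]; apply: big1 => v vP; rewrite H // nu.
rewrite addr0 (bigD1 (gplus k2)) // [X in _ + X = _]big1; last first.
  by move=> v /andP[vP /negbTE nv]; rewrite H // nv andbF.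
by rewrite H // !eqxx addr0.
Qed.

Lemma R_of_src u v : u \in Gp -> v \in Gp ->
  R (complete u (eta v)^-1, (v * xi u)%g) = 1.
Proof.
move=> uP vP; rewrite R_ofE gplus_complete ?bminus_complete ?groupV ?etaM //.
by rewrite gplusM ?gminusM ?xiM // !eqxx.
Qed.

Lemma sum_R_l (F : gT -> C) k1 v : v \in Gp ->
  \sum_(g | gplus g == v) R (k1, g) * F g =
  (bminus k1 == (eta v)^-1%g)%:R * F (v * xi (gplus k1))%g.
Proof.
move=> vP; rewrite (bigD1 (v * xi (gplus k1))%g) /=; last first.
  by rewrite gplusM ?xiM.
rewrite R_ofE gplusM ?gminusM ?xiM // eqxx andbT.
rewrite big1 ?addr0 // => g /andP[/eqP e ne]; rewrite R_ofE e.
case: (gminus g =P _) => [em|_]; last by rewrite andbF mul0r.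
by case/eqP: ne; rewrite -em -e gplusK.
Qed.

Lemma sum_R_r (F : gT -> C) u k2 : u \in Gp ->
  \sum_(g | gplus g == u) R (g, k2) * F g =
  (gminus k2 == xi u)%:R * F (complete u (eta (gplus k2))^-1).
Proof.
move=> uP; rewrite (bigD1 (complete u (eta (gplus k2))^-1)) /=; last first.
  by rewrite gplus_complete ?groupV ?etaM.
rewrite R_ofE gplus_complete ?bminus_complete ?groupV ?etaM // eqxx /=.
rewrite big1 ?addr0 // => g /andP[/eqP e ne]; rewrite R_ofE e.
case: (bminus g =P _) => [em|_]; last by rewrite mul0r.
by case/eqP: ne; rewrite -em -e completeK.
Qed.

Lemma hexagon_lE k1 k2 k3 :
  \sum_(g | gplus g == gplus k3) R (k1, g) * R (k2, ldiv g k3) =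
  [&& bminus k1 == (eta (gplus k3))^-1%g,
      bminus k2 == (eta (bplus (gplus k3 * xi (gplus k1))))^-1%g
    & gminus k3 == xi (gplus k1 * gplus k2)%g]%:R.
Proof.
rewrite sum_R_l // R_ofE -natrM mulnb; congr (nat_of_bool [&& _, _ & _])%:R.
  by rewrite gplus_ldiv // gplusM ?xiM.
rewrite gminus_ldiv; last by rewrite gplusM ?xiM.
rewrite gminusM ?xiM // morphM //.
by rewrite -[LHS](inj_eq (mulgI (xi (gplus k1)))) mulKVg.
Qed.

Lemma hexagon_l_exchange : hexagon_l R <-> exchange_eta xi eta.
Proof.
split=> [hex u v uP vP|ex k1 k2 k3].
  have yM : (eta (bplus (v * xi u)))^-1%g \in Gm by rewrite groupV etaM.
  (* This triple makes the right side equal to 1, so the delta on the left must hold, and that delta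
     is the exchange equation. *)
  have := hex (complete u (eta v)^-1%g) (eta (bplus (v * xi u)))^-1%g
    (v * xi u)%g.
  rewrite hexagon_lE gplus_complete ?bminus_complete ?groupV ?etaM //.
  rewrite (gplusM vP (xiM uP)) (gminusM vP (xiM uP)).
  rewrite (gplus_Gm yM) (bminus_id yM) mulg1 !eqxx /= => /eqP.
  rewrite gminus_complete // invgK (inj_eq invg_inj).
  by case: (gminus _ =P _) => // _; rewrite mul0r eq_sym oner_eq0.
rewrite hexagon_lE R_ofE -natrM mulnb gplusMl //; congr (nat_of_bool _)%:R.
apply/and3P/and3P => [[/eqP e1 /eqP e2 ->]|[/eqP e1 /eqP e2 ->]].
  move: e2; rewrite (bminus_paste e1) => e2; rewrite -e1 e2 eqxx; split=> //.
  by rewrite -{1}(completeK k1) e2 gminus_complete // invgK ex.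
have e : gminus k1 = bminus k2.
  by rewrite -{1}(completeK k1) e1 gminus_complete // invgK ex.
by rewrite (bminus_paste e) e1 e !eqxx.
Qed.

Lemma hexagon_rE k1 k2 k3 :
  \sum_(g | gplus g == gplus k1) R (g, k3) * R (ldiv g k1, k2) =
  [&& gminus k3 == xi (gplus k1), bminus k1 == (eta (gplus k2 * gplus k3))^-1%g
    & gminus k2 == xi (gplus (eta (gplus k3) * gplus k1))]%:R.
Proof.
rewrite sum_R_r // R_ofE -natrM mulnb; congr (nat_of_bool [&& _, _ & _])%:R.
  rewrite bminus_ldiv bminus_complete ?groupV ?etaM // invgK morphM // invMg.
  by rewrite -[RHS](inj_eq (mulgI (eta (gplus k3)))) mulKVg.
rewrite gplus_ldiv; last by rewrite gplus_complete ?groupV ?etaM.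
by rewrite bplus_complete ?groupV ?etaM // invgK.
Qed.

Lemma hexagon_r_exchange : hexagon_r R <-> exchange_xi xi eta.
Proof.
split=> [hex u v uP vP|ex k1 k2 k3].
  have yM : xi (gplus (eta v * u)) \in Gm by rewrite xiM.
  have := hex (complete u (eta v)^-1%g) (xi (gplus (eta v * u))) (v * xi u)%g.
  rewrite hexagon_rE gplus_complete ?bminus_complete ?groupV ?etaM //.
  rewrite (gplusM vP (xiM uP)) (gminusM vP (xiM uP)).
  rewrite (gplus_Gm yM) (gminus_id yM) !mul1g !eqxx /= => /eqP.
  by case: (xi _ =P _) => // _; rewrite mul0r eq_sym oner_eq0.
rewrite hexagon_rE R_ofE -natrM mulnb gplusMl // gminusMl //; congr (nat_of_bool _)%:R.
have ex' : gminus k3 = xi (gplus k1) ->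
    bminus k3 = xi (gplus (eta (gplus k3) * gplus k1)%g).
  by move=> e; rewrite -{1}(gplusK k3) e ex.
apply/and3P/and3P => [[/eqP e1 -> /eqP e2]|[/eqP e1 -> /eqP e2]].
  by rewrite e2 e1 ex' ?e2 // !eqxx.
by rewrite e1 e2 ex' ?e1 // !eqxx.
Qed.

Lemma R_of_counit : counit_id Gp Gm R = unit1 Gp C /\ id_counit Gp Gm R = unit1 Gp C.
Proof.
split; apply: functional_extensionality => k.
  rewrite counit_idE -(eq_bigl _ _ gplus_eq1); under eq_bigr do rewrite -[R _]mulr1.
  by rewrite sum_R_r // morph1 mulr1 gminus_eq1.
rewrite id_counitE -(eq_bigl _ _ gplus_eq1); under eq_bigr do rewrite -[R _]mulr1.
by rewrite sum_R_l // morph1 mulr1 invg1 bminus_eq1.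
Qed.

Lemma mul2_coprod_R a k1 k2 :
  mul2 Gp Gm (flip (coprod Gp Gm a)) R (k1, k2) =
  \sum_(g | gplus g == gplus k1) a (gplus k2 * g)%g *
     R (ldiv g k1, ldiv (gplus k2 * bminus g)%g k2).
Proof.
rewrite mul2_pairE; apply: eq_bigr => g _.
rewrite (bigD1 (gplus k2 * bminus g)%g) /=; last by rewrite gplusMr // gplus_id.
rewrite /flip coprodE /= gminusMl // gminus_id // eqxx mul1r gplusMr // gplus_id //.
rewrite big1 ?addr0 // => h /andP[/eqP e ne]; rewrite coprodE /=.
case: eqP => [em|_]; last by rewrite !mul0r.
by case/eqP: ne; rewrite -em -e gplusK.
Qed.

Lemma mul2_R_coprod a k1 k2 (t := gplus k1) (s := gplus k2)
    (h := ldiv (s * xi t) k2) :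
  mul2 Gp Gm R (coprod Gp Gm a) (k1, k2) =
  (gminus (eta s * k1) == bminus h)%:R * a (gplus (eta s * t) * h)%g.
Proof.
have tP : t \in Gp by exact: gplus_mem.
have sP : s \in Gp by exact: gplus_mem.
rewrite mul2_pairE.
under eq_bigr => g _ do
  rewrite (sum_R_l (fun x => coprod Gp Gm a (ldiv g k1, ldiv x k2))) //.
rewrite (bigD1 (complete t (eta s)^-1)) /=; last first.
  by rewrite gplus_complete ?groupV ?etaM.
rewrite bminus_complete ?groupV ?etaM // eqxx mul1r big1 ?addr0; last first.
  move=> g /andP[/eqP e ne]; case: eqP => [em|_]; last by rewrite mul0r.
  by case/eqP: ne; rewrite -em -[t]e completeK.
rewrite gplus_complete ?groupV ?etaM // coprodE /=.
have -> : ldiv (complete t (eta s)^-1) k1 = (eta s * k1)%g.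
  by rewrite /ldiv bminus_complete ?groupV ?etaM // invgK.
suff -> : gplus (eta s * k1) = gplus (eta s * t) by [].
by rewrite -{1}(gplusK k1) mulgA gplusMr.
Qed.

(** Testing on one basis element, at a place where the left side is 1, forces both the delta and the
    argument of [a] on the right. The plus and minus parts of the argument give [exchange_id] and
    the relation for [xi]; the delta at [t = 1] gives that for [eta]. *)
Lemma cocommutative_exchange :
  (forall a, mul2 Gp Gm (flip (coprod Gp Gm a)) R = mul2 Gp Gm R (coprod Gp Gm a)) ->
  [/\ exchange_id xi eta, intertwines xi & intertwines eta].
Proof.
move=> cc.
have key t s z : t \in Gp -> s \in Gp -> z \in Gm ->
    [/\ (s * t)%g = (gplus (eta s * t) * bplus (s * xi t))%g,
        (xi t * z)%g = (bminus (t * z) * xi (bplus (t * z)))%g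
      & t = 1%g -> (eta s * z)%g = (bminus (s * z) * eta (bplus (s * z)))%g].
  move=> tP sP zM; pose b := bminus (t * z).
  have bM : b \in Gm by exact: bminus_mem.
  pose y := (eta (bplus (s * b)))^-1%g.
  have yM : y \in Gm by rewrite groupV etaM.
  (* The pair [(l1, l2)] is the arrow of [R] composable with [(t * z, s * b)], and [(k1, k2)] is the
     composite. *)
  pose l1 := complete (bplus (t * z)) y.
  pose l2 := (bplus (s * b) * xi (bplus (t * z)))%g.
  pose k1 := (b * l1)%g; pose k2 := (bminus (s * b) * l2)%g.
  have gl1 : gplus l1 = bplus (t * z) by rewrite gplus_complete.
  have gl2 : gplus l2 = bplus (s * b) by rewrite gplusM ?xiM.
  have gk1 : gplus k1 = t by rewrite gplus_comp ?gl1 // gplusMr // gplus_id.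
  have gk2 : gplus k2 = s by rewrite gplus_comp ?gl2 // gplusMr // gplus_id.
  pose a : H1 gT C := fun g => (g == s * (t * z))%g%:R.
  have := congr1 (@^~ (k1, k2)) (cc a); rewrite /= mul2_coprod_R mul2_R_coprod.
  rewrite (bigD1 (t * z)%g) /=; last by rewrite gk1 gplusMr // gplus_id.
  rewrite gk1 gk2 -/b /a eqxx mul1r [ldiv (s * b) k2]ldiv_comp [ldiv (t * z) k1]ldiv_comp.
  rewrite /l1 /l2 R_of_src // big1 ?addr0; last first.
    by move=> g /andP[_ /negbTE ne]; rewrite (inj_eq (mulgI _)) ne mul0r.
  move/eqP; case: (gminus _ =P _) => [e1|_]; last by rewrite mul0r oner_eq0.
  case: (_ =P (s * (t * z))%g) => [e2|_]; last by rewrite mulr0 oner_eq0.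
  move=> _; have gsx : gplus (s * xi t) = gplus k2 by rewrite gplusM ?xiM.
  have c3 := congr1 gplus e2.
  rewrite (gplusMl _ (gplus_mem _)) (gplus_ldiv gsx) [(s * (t * z))%g]mulgA in c3.
  rewrite (gplusM (groupM sP tP) zM) in c3.
  have c4 := congr1 gminus e2.
  rewrite (gminusMl _ (gplus_mem _)) (gminus_ldiv gsx) (gminusM sP (xiM tP)) in c4.
  rewrite [(s * (t * z))%g]mulgA (gminusM (groupM sP tP) zM) in c4.
  have c5 : gminus k2 = (b * xi (bplus (t * z)))%g.
    by rewrite /k2 gminus_comp ?gl2 // (gminusM sP bM) (gminusM _ (xiM _)) ?bplus_mem.
  split=> // [|t1]; first by rewrite -c5 -c4 mulKVg.
  have tz : (t * z)%g = z by rewrite t1 mul1g.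
  have ys : y = (eta (bplus (s * z)))^-1%g by rewrite /y /b tz bminus_id.
  have l1y : l1 = y.
    by rewrite /l1 tz bplus_Gm // complete1.
  have k1E : k1 = (z * y)%g by rewrite /k1 l1y /b tz bminus_id.
  rewrite t1 mulg1 gplus_Gm ?etaM // !mul1g in e1 e2.
  rewrite e2 k1E gminus_id ?groupM ?etaM // ys in e1.
  by rewrite -e1 !mulgA mulgKV.
split.
- by move=> u v uP vP; have [] := key u v 1%g uP vP (group1 _).
- by move=> u z uP zM; have [] := key u 1%g z uP (group1 _) zM.
- by move=> u z uP zM; have [_ _ ->] := key 1%g u z (group1 _) uP zM.
Qed.

(** The relation for [xi] leaves only the term [g = t * z] on the left, [exchange_id] matches the
    two arguments of [a], and the relation for [eta] matches the two deltas. *)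
Lemma exchange_cocommutative :
  exchange_id xi eta -> intertwines xi -> intertwines eta ->
  forall a, mul2 Gp Gm (flip (coprod Gp Gm a)) R = mul2 Gp Gm R (coprod Gp Gm a).
Proof.
move=> c3 cx ce a; apply: functional_extensionality => -[k1 k2].
rewrite mul2_coprod_R mul2_R_coprod.
set t := gplus k1; set s := gplus k2; set h := ldiv (s * xi t) k2.
have tP : t \in Gp by exact: gplus_mem.
have sP : s \in Gp by exact: gplus_mem.
have gsx : gplus (s * xi t) = s by rewrite gplusM ?xiM.
pose z := gminus h; have zM : z \in Gm by exact: gminus_mem.
have ez : (xi t * z)%g = gminus k2.
  by rewrite /z /h gminus_ldiv // gminusMl // gminus_id ?xiM // mulKVg.
have eh : (gplus (eta s * t) * h)%g = (s * (t * z))%g.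
  have gh : gplus h = bplus (s * xi t) by exact: gplus_ldiv.
  by rewrite -{1}(gplusK h) gh [LHS]mulgA -c3 // [RHS]mulgA.
have gtz : gplus (t * z) = t by rewrite gplusM.
have gb g : gplus g = t -> gplus (s * bminus g) = s.
  by move=> e; rewrite gplusM.
have R1 g : gplus g = t -> R (ldiv g k1, ldiv (s * bminus g) k2) =
   ((bminus k1 == bminus g * (eta (bplus (s * bminus g)))^-1)%g && (g == (t * z)%g))%:R.
  move=> e; rewrite R_ofE bminus_ldiv !gplus_ldiv ?gb // gminus_ldiv ?gb //.
  rewrite -(inj_eq (mulgI (bminus g))) mulKVg gminusMl // gminus_id //.
  rewrite -[X in _ && X](inj_eq (mulgI (bminus g))) mulKVg.
  have := cx t (gminus g) tP (gminus_mem g); rewrite -{2 3}e gplusK => <-.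
  rewrite -ez (inj_eq (mulgI _)); congr (nat_of_bool (_ && _))%:R.
  apply/eqP/eqP => [->|->]; first by rewrite -e gplusK.
  by rewrite gminusMl // gminus_id.
rewrite (bigD1 (t * z)%g) /=; last by rewrite gtz.
rewrite big1 ?addr0; last first.
  by move=> g /andP[/eqP e /negbTE ne]; rewrite R1 // ne andbF mulr0.
rewrite R1 // eqxx andbT eh mulrC; congr ((nat_of_bool _)%:R * _).
set b := bminus (t * z); have bM : b \in Gm by exact: bminus_mem.
have -> : (b * (eta (bplus (s * b)))^-1 = (eta s)^-1 * bminus (s * (t * z)))%g.
  have -> : bminus (s * (t * z)) = bminus (s * b).
    by rewrite -(bminusK (t * z)) mulgA bminusMr.
  by apply: (canRL (mulKg _)); rewrite mulgA ce // mulgK.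
rewrite -(inj_eq (mulgI (eta s))) mulKVg -bminusMl ?etaM // -eh.
have -> : bminus (gplus (eta s * t) * h) = bminus (gplus (eta s * t) * bminus h).
  by rewrite -{1}(bminusK h) mulgA bminusMr.
have gt : gplus (eta s * k1) = gplus (eta s * t) by rewrite -(gplusK k1) mulgA gplusMr.
apply/eqP/eqP => [e|e]; last first.
  by rewrite -e -gt gplusK.
have -> : (eta s * k1 = gplus (eta s * t) * bminus h)%g.
  by apply: gplus_bminus_inj; rewrite // (gplusM (gplus_mem _) (bminus_mem _)).
by rewrite (gminusM (gplus_mem _) (bminus_mem _)).
Qed.

End Bisection.

(** * Recovering [xi] and [eta] from a positive structure *)

Section Reconstruction.
Variable R : H2 gT C.
Hypothesis R_ge0 : positive2 R.
Hypothesis R_qt : quasi_triangular Gp Gm R.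

Let hexl : hexagon_l R. Proof. by case/quasi_triangularP: R_qt. Qed.
Let hexr : hexagon_r R. Proof. by case/quasi_triangularP: R_qt. Qed.

Lemma R_bisection u v : u \in Gp -> v \in Gp ->
  exists2 g, src2 g = (u, v) /\ R g != 0 &
    forall h, src2 h = (u, v) -> R h != 0 -> h = g.
Proof.
have [hl hr cl cr cc] := (quasi_triangularP R).1 R_qt.
apply: (@nonneg_inverse_bisection R (antipode_id R)) => //.
- by move=> k; exact: R_ge0.
- exact: mul_antipode.
- exact: antipode_mul.
Qed.

Lemma R_uniq g h : R g != 0 -> R h != 0 -> src2 g = src2 h -> g = h.
Proof.
move=> Rg Rh e; have [k _ kP] := R_bisection (gplus_mem g.1) (gplus_mem g.2).
by rewrite (kP g) // (kP h).
Qed.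

(** By [R_uniq] the hexagon sum at the composite has a single nonzero term, so the delta on its
    other side cannot vanish. *)
Lemma paste_l k1 k2 g h : R (k1, g) != 0 -> R (k2, h) != 0 -> bplus g = gplus h ->
  gminus k1 = bminus k2 /\
  R ((gplus k1 * k2)%g, (bminus g * h)%g) = R (k1, g) * R (k2, h).
Proof.
move=> R1 R2 e; have := hexl k1 k2 (bminus g * h)%g.
rewrite (bigD1 g) /=; last by rewrite gplus_comp.
rewrite ldiv_comp big1 ?addr0; last first.
  move=> x /andP[/eqP ex ne]; apply/eqP; rewrite mulf_eq0; apply/orP; left.
  apply: contraR ne => Rx; apply/eqP.
  suff: (k1, x) = (k1, g) by case.
  by apply: R_uniq => //; rewrite /src2 /= ex gplus_comp.
case: (gminus k1 =P _) => [ek <-|_ /eqP]; first by rewrite mul1r.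
by rewrite mul0r eq_sym mulf_eq0 (negbTE R1) (negbTE R2).
Qed.

Lemma paste_r g l k2 k3 : R (g, k3) != 0 -> R (l, k2) != 0 -> bplus g = gplus l ->
  gminus k2 = bminus k3 /\
  R ((bminus g * l)%g, (gplus k2 * k3)%g) = R (g, k3) * R (l, k2).
Proof.
move=> R1 R2 e; have := hexr (bminus g * l)%g k2 k3.
rewrite (bigD1 g) /=; last by rewrite gplus_comp.
rewrite ldiv_comp big1 ?addr0; last first.
  move=> x /andP[/eqP ex ne]; apply/eqP; rewrite mulf_eq0; apply/orP; left.
  apply: contraR ne => Rx; apply/eqP.
  suff: (x, k3) = (g, k3) by case.
  by apply: R_uniq => //; rewrite /src2 /= ex gplus_comp.
case: (gminus k2 =P _) => [ek <-|_ /eqP]; first by rewrite mul1r.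
by rewrite mul0r eq_sym mulf_eq0 (negbTE R1) (negbTE R2).
Qed.

(** For [u] and [v] in [Gp] the default is never taken, by [arrowP]. *)
Definition arrow (u v : gT) : gT * gT :=
  odflt (1, 1)%g [pick k | (src2 k == (u, v)) && (R k != 0)].

Lemma arrowP u v : u \in Gp -> v \in Gp -> src2 (arrow u v) = (u, v) /\ R (arrow u v) != 0.
Proof.
move=> uP vP; rewrite /arrow; case: pickP => [k /andP[/eqP ]//|/= none].
have [k [e Rk] _] := R_bisection uP vP.
by have := none k; rewrite e eqxx Rk.
Qed.

Definition xi_fun u := gminus (arrow u 1%g).2.
Definition eta_fun v := (bminus (arrow 1%g v).1)^-1%g.

Lemma xi_fun_mem u : xi_fun u \in Gm. Proof. exact: gminus_mem. Qed.
Lemma eta_fun_mem v : eta_fun v \in Gm. Proof. by rewrite groupV. Qed.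

(** Pasting the arrow at [(gplus k1, 1)] with one whose second source is [gplus k2] gives an arrow
    with the source of [(k1, k2)], hence equal to it; such pasting leaves the minus part of the
    second component unchanged. So evaluating at [1] loses nothing in [xi_fun]. *)
Lemma gminus_snd k1 k2 : R (k1, k2) != 0 -> gminus k2 = xi_fun (gplus k1).
Proof.
move=> Rk; rewrite /xi_fun.
have [] := arrowP (gplus_mem k1) (group1 Gp).
case: (arrow _ _) => g k3 [] /= e1 e2 Rg.
have [] := arrowP (bplus_mem g) (gplus_mem k2).
case: (arrow _ _) => l h [] /= e3 e4 Rl.
have [_ e] := paste_r Rg Rl (esym e3).
have : (k1, k2) = ((bminus g * l)%g, (gplus h * k3)%g).
  apply: R_uniq => //; first by rewrite e mulf_neq0.
  by rewrite /src2 /= gplus_comp // e1 gplusMl // e4 e2 mulg1.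
by case=> _ ->; rewrite gminusMl.
Qed.

Lemma bminus_fst k1 k2 : R (k1, k2) != 0 -> bminus k1 = (eta_fun (gplus k2))^-1%g.
Proof.
move=> Rk; rewrite /eta_fun invgK.
have [] := arrowP (group1 Gp) (gplus_mem k2).
case: (arrow _ _) => l g [] /= e1 e2 Rl.
have [] := arrowP (gplus_mem k1) (bplus_mem g).
case: (arrow _ _) => h1 h2 [] /= e3 e4 Rh.
have [ep e] := paste_l Rl Rh (esym e4).
have : (k1, k2) = ((gplus l * h1)%g, (bminus g * h2)%g).
  apply: R_uniq => //; first by rewrite e mulf_neq0.
  by rewrite /src2 /= gplus_comp // e2 gplusMl // e3 e1 mul1g.
by case=> -> _; rewrite bminus_paste.
Qed.

(** Under [paste_l] the first sources multiply, and so do the minus parts of the second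
    components. *)
Lemma xi_funM : {in Gp &, {morph xi_fun : x y / (x * y)%g}}.
Proof.
move=> u v uP vP.
have [] := arrowP uP (group1 Gp); case: (arrow _ _) => k1 g [] /= e1 e2 Rg.
have [] := arrowP vP (bplus_mem g); case: (arrow _ _) => k2 h [] /= e3 e4 Rh.
have [_ e] := paste_l Rg Rh (esym e4).
have := gminus_snd (_ : R ((gplus k1 * k2)%g, (bminus g * h)%g) != 0).
rewrite e mulf_neq0 // => /(_ isT).
rewrite gplusMl // e1 e3 => <-; rewrite gminus_comp //.
by rewrite (gminus_snd Rg) (gminus_snd Rh) e1 e3.
Qed.

Lemma eta_funM : {in Gp &, {morph eta_fun : x y / (x * y)%g}}.
Proof.
move=> u v uP vP.
have [] := arrowP (group1 Gp) vP; case: (arrow _ _) => g k3 [] /= e1 e2 Rg.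
have [] := arrowP (bplus_mem g) uP; case: (arrow _ _) => l k2 [] /= e3 e4 Rl.
have [_ e] := paste_r Rg Rl (esym e3).
have := bminus_fst (_ : R ((bminus g * l)%g, (gplus k2 * k3)%g) != 0).
rewrite e mulf_neq0 // => /(_ isT).
rewrite gplusMl // e2 e4 bminusMl // (bminus_fst Rg) (bminus_fst Rl) e2 e4 => e5.
by apply: invg_inj; rewrite -e5 invMg.
Qed.

Definition xi_morphism : {morphism Gp >-> gT} := Morphism xi_funM.
Definition eta_morphism : {morphism Gp >-> gT} := Morphism eta_funM.

Lemma xi_morphismP : (xi_morphism @* Gp \subset Gm)%g.
Proof. by apply/subsetP=> _ /morphimP[u _ _ ->]; exact: xi_fun_mem. Qed.

Lemma eta_morphismP : (eta_morphism @* Gp \subset Gm)%g.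
Proof. by apply/subsetP=> _ /morphimP[u _ _ ->]; exact: eta_fun_mem. Qed.

(** * The coefficients of [R] on its support are 1 *)

Definition coef u v := R (arrow u v).

Lemma arrowE k : R k != 0 -> arrow (gplus k.1) (gplus k.2) = k.
Proof.
move=> Rk; have [e Rg] := arrowP (gplus_mem k.1) (gplus_mem k.2).
exact: R_uniq.
Qed.

Lemma coef_neq0 u v : u \in Gp -> v \in Gp -> coef u v != 0.
Proof. by move=> uP vP; case: (arrowP uP vP). Qed.

(** Pasted arrows have multiplied coefficients; the second source moves along the first arrow, which
    is the twist in this cocycle identity. *)
Lemma coefMl u1 u2 v : u1 \in Gp -> u2 \in Gp -> v \in Gp ->
  coef (u1 * u2)%g v = coef u1 v * coef u2 (bplus (v * xi_fun u1)).
Proof.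
move=> u1P u2P vP; rewrite /coef.
have [] := arrowP u1P vP; case E: (arrow u1 v) => [k1 g] [] /= e1 e2 Rg.
have eg : g = (v * xi_fun u1)%g by rewrite -(gplusK g) e2 (gminus_snd Rg) e1.
rewrite -eg; have [] := arrowP u2P (bplus_mem g).
case E': (arrow u2 _) => [k2 h] [] /= e3 e4 Rh.
have [_ e] := paste_l Rg Rh (esym e4); rewrite -e.
have := @arrowE ((gplus k1 * k2)%g, (bminus g * h)%g).
rewrite /= gplus_comp // gplusMl // e1 e2 e3 => -> //.
by rewrite -e1 e mulf_neq0.
Qed.

Lemma coefMr u v1 v2 : u \in Gp -> v1 \in Gp -> v2 \in Gp ->
  coef u (v1 * v2)%g = coef u v2 * coef (gplus (eta_fun v2 * u)) v1.
Proof.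
move=> uP v1P v2P; rewrite /coef.
have [] := arrowP uP v2P; case E: (arrow u v2) => [g k3] [] /= e1 e2 Rg.
have eg : bplus g = gplus (eta_fun v2 * u).
  rewrite -(completeK g) e1 (bminus_fst Rg) e2.
  by rewrite bplus_complete ?groupV ?eta_fun_mem // invgK.
rewrite -eg; have [] := arrowP (bplus_mem g) v1P.
case E': (arrow _ v1) => [l k2] [] /= e3 e4 Rl.
have [_ e] := paste_r Rg Rl (esym e3); rewrite -e.
have := @arrowE ((bminus g * l)%g, (gplus k2 * k3)%g).
rewrite /= gplus_comp // gplusMl // e1 e2 e4 => -> //.
by rewrite -e4 e mulf_neq0.
Qed.

Definition row u := \prod_(v in Gp) coef u v.

Lemma row_neq0 u : u \in Gp -> row u != 0.
Proof. by move=> uP; apply/prodf_neq0 => v vP; exact: coef_neq0. Qed.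

(** The factors [coef u2 (v^{xi u1})] of [row (u1 * u2)] only permute those of [row u2],
    so [row] is a homomorphism from a finite group to the positive reals. *)
Lemma rowM u1 u2 : u1 \in Gp -> u2 \in Gp -> row (u1 * u2)%g = row u1 * row u2.
Proof.
move=> u1P u2P; rewrite /row (eq_bigr _ (fun v vP => coefMl u1P u2P vP)) big_split /=.
congr (_ * _); pose x := xi_fun u1; have xM : x \in Gm by exact: xi_fun_mem.
have shift y z v : v \in Gp -> (y * z)%g = 1%g -> bplus (bplus (v * y) * z) = v.
  move=> vP yz; rewrite -(bplusMl _ (bminus_mem (v * y))) mulgA bminusK.
  by rewrite -mulgA yz mulg1 bplus_id.
rewrite [RHS](reindex_onto (fun v => bplus (v * x)) (fun v => bplus (v * x^-1))) /=.
  apply: eq_bigl => v; rewrite bplus_mem /=.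
  by apply/idP/eqP => [vP|<- //]; rewrite shift ?mulgV.
by move=> v vP; rewrite shift ?mulVg.
Qed.

Lemma row1 : row 1%g = 1.
Proof.
have := rowM (group1 Gp) (group1 Gp); rewrite mulg1 -{1}[row _]mulr1.
by move/(mulfI (row_neq0 (group1 Gp)))/esym.
Qed.

(** The order of [u] makes [row u] a root of unity, and the only non-negative one is 1. *)
Lemma row_eq1 u : u \in Gp -> row u = 1.
Proof.
move=> uP; have rX n : row (u ^+ n)%g = row u ^+ n.
  elim: n => [|n IHn]; first by rewrite row1.
  by rewrite expgS exprS rowM ?groupX // IHn.
have := rX #[u]%g; rewrite expg_order row1 => /esym/eqP.
rewrite pexpr_eq1 ?order_gt0 //; first by move/eqP.
by apply: prodr_ge0 => v _; exact: R_ge0.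
Qed.

(** Multiplying [coefMr] over all [v1] relates two rows, both equal to 1, by the power [#|Gp|] of
    [coef u v]; a non-negative root of unity is 1. *)
Lemma coef_eq1 u v : u \in Gp -> v \in Gp -> coef u v = 1.
Proof.
move=> uP vP; have := row_eq1 uP.
rewrite /row (reindex_onto (fun w => w * v)%g (fun w => w * v^-1)%g) /=; last first.
  by move=> w _; rewrite mulgKV.
under eq_bigl => w do rewrite groupMr // mulgK eqxx andbT.
rewrite (eq_bigr _ (fun w wP => coefMr uP wP vP)) big_split /= -/(row _) row_eq1 //.
rewrite prodr_const mulr1 => /eqP; rewrite pexpr_eq1 ?cardG_gt0 //; first by move/eqP.
exact: R_ge0.
Qed.

Lemma R_eq_R_of : R = R_of Gp Gm C xi_morphism eta_morphism.
Proof.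
apply: functional_extensionality => -[k1 k2]; rewrite R_ofE ?xi_morphismP ?eta_morphismP //=.
(* If [R] vanished where the formula gives 1, the arrow of [R] with the same source would have the
   same coordinates, hence be this very pair. *)
have [R0|Rk] := eqVneq (R (k1, k2)) 0.
  rewrite R0; case: andP => // -[/eqP e1 /eqP e2].
  have [] := arrowP (gplus_mem k1) (gplus_mem k2).
  case: (arrow _ _) => h1 h2 [] /= e3 e4 Rh.
  have h1E : h1 = k1 by apply: gplus_bminus_inj; rewrite // (bminus_fst Rh) e4 e1.
  have h2E : h2 = k2 by apply: gplus_gminus_inj; rewrite // (gminus_snd Rh) e3 e2.
  by move: Rh; rewrite h1E h2E R0 eqxx.
rewrite (bminus_fst Rk) (gminus_snd Rk) !eqxx /=.
by rewrite -(arrowE Rk) /= [LHS]coef_eq1.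
Qed.

End Reconstruction.

End Algebra.
End Factorization.

Theorem theorem1 (gT : finGroupType) (Gp Gm : {group gT})
    (C : numClosedFieldType) :
  unique_factorization Gp Gm ->
  forall R : H2 gT C,
    (positive2 R /\ quasi_triangular Gp Gm R) <->
    (exists xi eta : {morphism Gp >-> gT},
       [/\ (xi @* Gp \subset Gm)%g, (eta @* Gp \subset Gm)%g,
           cond_a Gp xi eta, cond_b Gp xi eta
         & R = R_of Gp Gm C xi eta]).
Proof.
move=> fact R; split=> [[R0 Rq]|[xi [eta [xiP etaP ca cb ->]]]].
  have xiP := xi_morphismP fact R0 Rq; have etaP := eta_morphismP fact R0 Rq.
  exists (xi_morphism fact R0 Rq), (eta_morphism fact R0 Rq).
  have RE := R_eq_R_of fact R0 Rq; move: xiP etaP RE.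
  (* The morphisms are built from [R]; generalizing them lets [R] be replaced by its formula. *)
  move: (xi_morphism fact R0 Rq) (eta_morphism fact R0 Rq) => xi eta xiP etaP RE.
  have [hl hr _ _ cc] := (quasi_triangularP fact R).1 Rq.
  rewrite RE in hl hr cc.
  have [c3 cx ce] := cocommutative_exchange fact xiP etaP cc.
  have [] := compat_cond_ab fact xiP etaP
    ((hexagon_l_exchange fact C xiP etaP).1 hl) ((hexagon_r_exchange fact C xiP etaP).1 hr)
    c3 cx ce.
  by split.
have [c1 c2 c3 cx ce] := cond_ab_compat fact xiP etaP ca cb.
split; first by move=> [k1 k2]; rewrite R_ofE // Num.Theory.ler0n.
apply/(quasi_triangularP fact); have [cl cr] := R_of_counit fact C xiP etaP; split=> //.
- exact/(hexagon_l_exchange fact C xiP etaP).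
- exact/(hexagon_r_exchange fact C xiP etaP).
- exact: exchange_cocommutative.
Qed.
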